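(* Let $Q\subset\mathbb{R}^n$ be a cube, $0<s\le 1/2$, $1/2\le t\le 1-s$, $\delta,\beta>0$, and $f$ a measurable function on $Q$. If $|m_f(t,Q)|\le\delta$, then there exists a (possibly empty) family of nonoverlapping dyadic subcubes $\{Q_k\}$ of $Q$ such that \begin{enumerate} \item[(1)] $Q_k\not\subset\{y\in Q: M^{\sharp}_{0,s,Q}f(y)>\beta\}$ for each $k$; \item[(2)] $\delta<|m_f(t,Q_k)|\le\delta+10\,n\,\beta$ for each $k$; \item[(3)] $|f(x)|\le\delta$ for a.e. $x\in Q\setminus\big(\{y\in Q: M^{\sharp}_{0,s,Q}f(y)>\beta\}\cup\bigcup_k Q_k\big)$. \end{enumerate}
   Context: Cubes have sides parallel to the coordinate axes; $|E|$ is Lebesgue measure; functions are real-valued. Nonoverlapping means having disjoint interiors. The dyadic subcubes of $Q$ are those obtained by successively subdividing $Q$ into $2^n$ congruent subcubes. For a cube $Q$, $0<t<1$ and a measurable $f$ on $Q$, the maximal median is $$m_f(t,Q)=\sup\{M\in\mathbb{R}: |\{y\in Q: f(y)<M\}|\le t|Q|\}.$$ For $0<s\le1/2$, the local sharp maximal function restricted to $Q$ is, for $x\in Q$, $$M^{\sharp}_{0,s,Q}f(x)=\sup_{x\in Q',\,Q'\subset Q}\ \inf_{c}\ \inf\{\alpha\ge0: |\{y\in Q': |f(y)-c|>\alpha\}|<s|Q'|\},$$ where the supremum is over cubes $Q'$ and $c$ ranges over real constants. *)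

(* Defs.v *)
From HB Require Import structures.
From mathcomp Require Import all_boot all_order all_algebra.
From mathcomp Require Import all_classical all_reals all_analysis.

Set Implicit Arguments.
Unset Strict Implicit.
Unset Printing Implicit Defensive.

Import Order.TTheory GRing.Theory Num.Theory.
Import numFieldNormedType.Exports.

Local Open Scope classical_set_scope.
Local Open Scope ring_scope.

(* MathComp-Analysis has no n-dimensional Lebesgue measure: it is built here
   as the Caratheodory measure of the usual outer measure. The space R^n,
   n >= 1, is 'rV[R]_m.+1 with n = m.+1. *)
Section lebesgue_rV.
Context {R : realType} {m : nat}.
Implicit Types (a b : 'rV[R]_m.+1) (A : set 'rV[R]_m.+1).

Definition box a b : set 'rV[R]_m.+1 :=
  [set x | forall i, a ord0 i <= x ord0 i <= b ord0 i].

Definition box_volume a b : R := \prod_i (b ord0 i - a ord0 i).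

Definition box_cover A : set (nat -> 'rV[R]_m.+1 * 'rV[R]_m.+1) :=
  fun B => (forall k i, (B k).1 ord0 i <= (B k).2 ord0 i) /\
           A `<=` \bigcup_k box (B k).1 (B k).2.

Local Open Scope ereal_scope.

Definition lebesgue_outer A : \bar R :=
  ereal_inf [set \sum_(k <oo) (box_volume (B k).1 (B k).2)%:E
            | B in box_cover A].

Let vol (p : 'rV[R]_m.+1 * 'rV[R]_m.+1) : \bar R := (box_volume p.1 p.2)%:E.

Let vol_ge0 A B k : box_cover A B -> 0 <= vol (B k).
Proof.
by move=> [le_B _]; rewrite lee_fin prodr_ge0// => i _; rewrite subr_ge0.
Qed.

Lemma lebesgue_outer_ge0 A : 0 <= lebesgue_outer A.
Proof.
apply: le_ereal_inf_tmp => _ [B AB <-].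
by apply: nneseries_ge0 => k _ _; exact: vol_ge0 AB.
Qed.

Lemma lebesgue_outer0 : lebesgue_outer set0 = 0.
Proof.
apply/eqP; rewrite eq_le lebesgue_outer_ge0 andbT.
apply: ereal_inf_lbound; exists (fun=> (0, 0)%R); first by split.
apply: eseries0 => k _ _ /=; congr EFin.
by rewrite /box_volume big_ord_recl/= subrr mul0r.
Qed.

Lemma le_lebesgue_outer : {homo lebesgue_outer : A B / A `<=` B >-> A <= B}.
Proof.
move=> A A' AA'; apply: ereal_inf_le_tmp => _ [B [le_B A'B] <-].
by exists B => //; split => //; exact: subset_trans A'B.
Qed.

Lemma lebesgue_outer_sigma_subadditive : sigma_subadditive lebesgue_outer.
Proof.
move=> A; have [[i ioo]|] := pselect (exists i, lebesgue_outer (A i) = +oo).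
  rewrite (eseries_pinfty _ _ ioo) ?leey// => n _.
  by rewrite -ltNye (lt_le_trans _ (lebesgue_outer_ge0 _)).
rewrite -forallNE => Aoo.
apply/lee_addgt0Pr => e e0.
apply: le_trans (epsilon_trick _ _ (ltW e0)); last first.
  by move=> n; exact: lebesgue_outer_ge0.
have [G PG] : {G : nat -> nat -> _ & forall n, box_cover (A n) (G n) /\
    \sum_(k <oo) vol (G n k) <=
      lebesgue_outer (A n) + (e / (2 ^ n.+1)%:R)%:E}.
  apply: (@choice _ _ (fun n g => box_cover (A n) g /\
    \sum_(k <oo) vol (g k) <=
      lebesgue_outer (A n) + (e / (2 ^ n.+1)%:R)%:E)) => n.
  have en : (0 < e / (2 ^ n.+1)%:R)%R by rewrite divr_gt0// ltr0n expn_gt0.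
  have An : lebesgue_outer (A n) \is a fin_num.
    by rewrite ge0_fin_numE ?lebesgue_outer_ge0// ltey; exact/eqP/Aoo.
  by have [_ [B AB <-] /ltW ?] := lb_ereal_inf_adherent en An; exists B.
have G_ge0 p : 0 <= (vol \o uncurry G) p.
  by case: p => n k; exact: vol_ge0 (PG n).1.
apply: (@le_trans _ _ (\esum_(p in setT) (vol \o uncurry G) p)).
  have /card_esym/ppcard_eqP[f] := card_nat2.
  apply: ereal_inf_lbound; exists (uncurry G \o f).
    split=> [k i|x [n _ Anx]].
      by rewrite /=; case: (f k) => n l; exact: (PG n).1.1.
    have [k _ xk] := (PG n).1.2 _ Anx.
    by exists (f^-1%FUN (n, k)) => //=; rewrite invK ?inE.
  rewrite -(esum_pred_image (vol \o uncurry G) _ xpredT) ?[fun=> _]set_true//.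
  by rewrite image_eq.
rewrite (_ : esum _ _ = \sum_(i <oo) \sum_(j <oo) vol (G i j)); last first.
  pose J : nat -> set (nat * nat) := fun i => [set (i, j) | j in setT].
  rewrite (_ : setT = \bigcup_k J k); last first.
    by rewrite predeqE => -[a b]; split => // _; exists a => //; exists b.
  rewrite esum_bigcupT /=; last 2 first.
  - apply/trivIsetP => i j _ _ ij.
    rewrite predeqE => -[n k] /=; split => //= -[] [_] _ [<-{n} _].
    by move=> [k' _] [] /esym/eqP; rewrite (negbTE ij).
  - by [].
  rewrite -(image_id [set: nat]) -fun_true esum_pred_image//; last first.
    by move=> n _; apply: esum_ge0 => p _; exact: G_ge0.
  apply: eq_eseriesr => /= j _.
  rewrite -(esum_pred_image (vol \o uncurry G) (pair j) predT)//=; last 2 first.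
  - by move=> k _; exact: (G_ge0 (j, k)).
  - by move=> ? ? _ _; exact: (@can_inj _ _ _ snd).
  by congr esum; rewrite predeqE => -[a b]; split; move=> [i _ <-]; exists i.
apply: lee_nneseries => [n _ _|n _]; last exact: (PG n).2.
by apply: nneseries_ge0 => k _ _; exact: (G_ge0 (n, k)).
Qed.

HB.instance Definition _ := isOuterMeasure.Build R 'rV[R]_m.+1 lebesgue_outer
  lebesgue_outer0 lebesgue_outer_ge0 le_lebesgue_outer
  lebesgue_outer_sigma_subadditive.

End lebesgue_rV.

(* R^n, n = m.+1, with the sigma-algebra of Lebesgue measurable sets *)
Notation lebesgue_rV R m := (caratheodory_type (@lebesgue_outer R m)).

Definition lebesgue_measure_rV {R : realType} {m : nat} :
  set (lebesgue_rV R m) -> \bar R := @lebesgue_outer R m.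

HB.instance Definition _ (R : realType) (m : nat) :=
  isMeasure.Build _ (lebesgue_rV R m) R (@lebesgue_measure_rV R m)
    (@caratheodory_measure0 R _ (@lebesgue_outer R m))
    (@caratheodory_measure_ge0 R _ (@lebesgue_outer R m))
    (@caratheodory_measure_sigma_additive R _ (@lebesgue_outer R m)).

Section cubes.
Context {R : realType} {m : nat}.
Implicit Types (a : 'rV[R]_m.+1) (l : R) (P Q : set 'rV[R]_m.+1).

(* cubes are closed and nondegenerate (see is_cube) *)
Definition cube a l : set 'rV[R]_m.+1 := box a (a + const_mx l).

Definition is_cube Q := exists a l, 0 < l /\ Q = cube a l.

(* P is one of the 2^n congruent cubes obtained by halving the sides of Q *)
Definition cube_child Q P :=
  exists a l (e : 'I_m.+1 -> bool),
    [/\ 0 < l, Q = cube a l &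
        P = cube (a + \row_i (if e i then l / 2 else 0)) (l / 2)].

Inductive dyadic_subcube Q : set 'rV[R]_m.+1 -> Prop :=
| dyadic_subcube_refl : dyadic_subcube Q Q
| dyadic_subcube_child P P' :
    dyadic_subcube Q P -> cube_child P P' -> dyadic_subcube Q P'.

Definition nonoverlapping (F : set (set 'rV[R]_m.+1)) :=
  forall P P', F P -> F P' -> P <> P' -> interior P `&` interior P' = set0.

End cubes.

Section median_oscillation.
Context {R : realType} {m : nat}.
Implicit Types (f : 'rV[R]_m.+1 -> R) (Q : set 'rV[R]_m.+1) (s t : R).
Local Open Scope ereal_scope.

Let mu : set 'rV[R]_m.+1 -> \bar R := lebesgue_measure_rV.

Definition maximal_median f t Q : \bar R :=
  ereal_sup [set M%:E | M in
    [set M : R | mu (Q `&` [set y | (f y < M)%R]) <= t%:E * mu Q]].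

Definition local_oscillation s f Q : \bar R :=
  ereal_inf [set
    ereal_inf [set alpha%:E | alpha in
      [set alpha : R | (0 <= alpha)%R /\
        mu (Q `&` [set y | (alpha < `|f y - c|)%R]) < s%:E * mu Q]]
  | c in [set: R]].

Definition local_sharp_maximal s Q f (x : 'rV[R]_m.+1) : \bar R :=
  ereal_sup [set local_oscillation s f Q' | Q' in
    [set Q' | [/\ is_cube Q', Q' `<=` Q & Q' x]]].

End median_oscillation.

(* Main.v *)
(* Take for [F] the stopping cubes: the dyadic cubes P, not contained in E, that
   are first on their branch with |m_f(t,P)| > delta.

   Upper bound in (2): let P' be the parent of P and y in P \ E. Every cube R
   with P <= R <= P' contains y, so f is within b = 5/4 beta of a constant c_R on
   more than half of R (and even on more than (1 - s)|R|, so m_f(t,R) is within b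
   of c_R). Let R_v interpolate between P and P', with volume proportional to v
   in [1, 2^n]. If c_u, c_v, c_w are pairwise more than 2b apart, then
   (u + v + w)/2 < w, which is impossible for u < v < w <= 2u. By strictness c
   moves by at most 2b near each v, so a supremum argument produces such a triple
   unless c varies by at most 6b when v doubles. After n doublings the medians
   differ by at most 6nb + 2b <= 8nb = 10 n beta. Mere comparison of finitely many
   cubes would not do when s = 1/2.

   For (3), points outside E and all stopping cubes have |m_f(t,P)| <= delta for
   all dyadic P containing them; where |f| > delta this contradicts the dyadic
   density theorem, up to a null set. *)
Require Import Defs.
From HB Require Import structures.
From mathcomp Require Import all_boot all_order all_algebra.
From mathcomp Require Import all_classical all_reals all_analysis.
From mathcomp Require Import ring lra.

Import Order.TTheory GRing.Theory Num.Theory.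
Import numFieldNormedType.Exports.

Local Open Scope classical_set_scope.
Local Open Scope ring_scope.

(** * Outer measure of boxes, half-spaces and cubes *)

Section boxes.
Context {R : realType} {m : nat}.
Implicit Types (a b x : 'rV[R]_m.+1) (A H : set 'rV[R]_m.+1).
Local Notation mu := (@lebesgue_outer R m).

Lemma box_volume_ge0 a b : (forall i, a ord0 i <= b ord0 i) ->
  0 <= box_volume a b.
Proof. by move=> ab; apply: prodr_ge0 => i _; rewrite subr_ge0. Qed.

Lemma lebesgue_outer_box a b : (forall i, a ord0 i <= b ord0 i) ->
  (mu (box a b) <= (box_volume a b)%:E)%E.
Proof.
move=> ab; apply: ereal_inf_lbound.
(* Covers are infinite sequences: the box is followed by copies of the degenerate box at the origin,
   of volume zero. *)
exists (fun k => if k == 0%N then (a, b) else (0, 0)).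
  by split=> [k i|x abx]; [case: ifP | exists 0%N].
rewrite nneseries_recl//= => [|k _]; last first.
  by case: eqP => _; rewrite lee_fin box_volume_ge0.
rewrite eseries0 ?adde0// => -[|k]//= _ _.
by rewrite /box_volume big_ord_recl subrr mul0r.
Qed.

Definition set_coord a i (c : R) : 'rV[R]_m.+1 :=
  \row_j (if j == i then c else a ord0 j).

Lemma box_volume_set_coord a b i c d :
  box_volume (set_coord a i c) (set_coord b i d) =
  (d - c) * \prod_(j | j != i) (b ord0 j - a ord0 j).
Proof.
rewrite /box_volume (bigD1 i)//= !mxE eqxx; congr (_ * _).
by apply: eq_bigr => j /negbTE ji; rewrite !mxE ji.
Qed.

Lemma set_coord_id a i : set_coord a i (a ord0 i) = a.
Proof. by apply/rowP => j; rewrite !mxE; case: eqP => [->|]. Qed.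

Lemma lebesgue_outer_boxI_hyperplane a b i c :
  mu (box a b `&` [set x | x ord0 i = c]) = 0%E.
Proof.
apply/eqP; rewrite eq_le lebesgue_outer_ge0 andbT.
have [ab|] := pselect (forall j, a ord0 j <= b ord0 j); last first.
  move=> ab; rewrite (_ : _ `&` _ = set0) ?lebesgue_outer0//.
  apply/seteqP; split=> // x [abx _]; apply: ab => j.
  by have /andP[/le_trans h /h] := abx j.
apply: (@le_trans _ _ (mu (box (set_coord a i c) (set_coord b i c)))).
  by apply: le_lebesgue_outer => x [abx xc] j; rewrite !mxE; case: eqP => [->|//];
    rewrite xc lexx.
apply: le_trans (lebesgue_outer_box _ _ _) _ => [j|].
  by rewrite !mxE; case: ifP.
by rewrite box_volume_set_coord subrr mul0r.
Qed.

(** Each box of a cover of [X] is cut by the hyperplane into two boxes whose volumes add up. The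
    hypotheses leave the hyperplane itself undecided, so that open and closed half-spaces are
    treated together. *)
Lemma caratheodory_halfspace H i c :
  (forall x, x ord0 i < c -> H x) -> (forall x, H x -> x ord0 i <= c) ->
  (mu.-caratheodory H).
Proof.
move=> ltH Hle; apply: le_caratheodory_measurable => X.
apply: le_ereal_inf_tmp => _ [B [le_B XB] <-].
(* [c] is clamped to the side of the box, so that a box missing the hyperplane is cut at one of its
   own faces and one piece is degenerate. *)
pose d k := Num.max ((B k).1 ord0 i) (Num.min ((B k).2 ord0 i) c).
have d1 k : (B k).1 ord0 i <= d k by rewrite /d le_max lexx.
have d2 k : d k <= (B k).2 ord0 i by rewrite /d ge_max le_B ge_min lexx.
pose B1 k := ((B k).1, set_coord (B k).2 i (d k)).
pose B2 k := (set_coord (B k).1 i (d k), (B k).2).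
have le_B1 k j : (B1 k).1 ord0 j <= (B1 k).2 ord0 j.
  by rewrite /= !mxE; case: eqP => [->|].
have le_B2 k j : (B2 k).1 ord0 j <= (B2 k).2 ord0 j.
  by rewrite /= !mxE; case: eqP => [->|].
have volB k : ((box_volume (B k).1 (B k).2)%:E =
   (box_volume (B1 k).1 (B1 k).2)%:E + (box_volume (B2 k).1 (B2 k).2)%:E)%E.
  rewrite -EFinD /=; congr EFin.
  rewrite -{1 2}[(B k).1](set_coord_id _ i) -[in X in _ + X](set_coord_id (B k).2 i).
  rewrite -{1}[(B k).2](set_coord_id _ i) !box_volume_set_coord -mulrDl.
  by rewrite [X in X * _](_ : _ = (d k - (B k).1 ord0 i) + ((B k).2 ord0 i - d k))//; ring.
rewrite (eq_eseriesr (fun k _ => volB k)) nneseriesD; last 2 first.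
- by move=> k _ _; rewrite lee_fin box_volume_ge0.
- by move=> k _ _; rewrite lee_fin box_volume_ge0.
apply: leeD; apply: ereal_inf_lbound.
  exists B1 => //; split=> // x [/XB[k _ Bkx] /Hle xc]; exists k => // j.
  rewrite !mxE; case: eqP => [->|_]; last exact: Bkx.
  by have /andP[-> xb] := Bkx i; rewrite le_max le_min xb xc orbT.
exists B2 => //; split=> // x [/XB[k _ Bkx] nHx]; exists k => // j.
rewrite !mxE; case: eqP => [->|_]; last exact: Bkx.
have /andP[ax ->] := Bkx i; rewrite ge_max ax ge_min andbT.
by rewrite orbC leNgt; case: ltP => // /ltH.
Qed.

Lemma measurable_halfspace_le i c :
  measurable ([set x | x ord0 i <= c] : set (lebesgue_rV R m)).
Proof. by apply: (@caratheodory_halfspace _ i c) => // x /ltW. Qed.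

Lemma measurable_halfspace_lt i c :
  measurable ([set x | x ord0 i < c] : set (lebesgue_rV R m)).
Proof. by apply: (@caratheodory_halfspace _ i c) => // x /ltW. Qed.

Lemma measurable_box a b : measurable (box a b : set (lebesgue_rV R m)).
Proof.
rewrite (_ : box a b = \bigcap_(i in [set: 'I_m.+1])
  (~` [set x | x ord0 i < a ord0 i] `&` [set x | x ord0 i <= b ord0 i])).
  apply: fin_bigcap_measurable => // i _; apply: measurableI.
    exact: measurableC (measurable_halfspace_lt _ _).
  exact: measurable_halfspace_le.
apply/seteqP; split=> x /=.
  by move=> abx i _; have /andP[ax xb] := abx i; split=> //=; apply/negP; rewrite -leNgt.
by move=> abx i; have [/negP + xb] := abx i I; rewrite -leNgt => ->.
Qed.

(** The affine map [x |-> a + r *: (x - a')], with [r] the ratio of the sides, carries a cover of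
    the second cube to a cover of the first and multiplies volumes by [r ^+ m.+1]. *)
Lemma lebesgue_outer_cube_le a a' (l l' : R) : 0 < l -> 0 < l' ->
  (mu (cube a l) <= ((l / l') ^+ m.+1)%:E * mu (cube a' l'))%E.
Proof.
move=> l0 l'0; set r := l / l'.
have r0 : 0 < r by rewrite divr_gt0.
have rl : r * l' = l by rewrite /r divfK ?gt_eqF.
rewrite -lee_pdivrMl ?exprn_gt0//.
apply: le_ereal_inf_tmp => _ [B [le_B cB] <-].
rewrite lee_pdivrMl ?exprn_gt0// -nneseriesZl; last first.
  by move=> k _; rewrite lee_fin box_volume_ge0.
apply: ereal_inf_lbound.
exists (fun k => (a + r *: ((B k).1 - a'), a + r *: ((B k).2 - a'))).
  split=> [k i /=|x ax].
    by rewrite !mxE lerD2l ler_pM2l// lerD2r.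
  have /cB[k _ Bk] : cube a' l' (a' + r^-1 *: (x - a)).
    move=> i; have := ax i; rewrite !mxE lerDl lerD2l => /andP[h1 h2].
    rewrite mulr_ge0 ?invr_ge0 ?(ltW r0) ?subr_ge0//=.
    by rewrite ler_pdivrMl// rl lerBlDl.
  exists k => // i; have := Bk i; rewrite !mxE /=.
  rewrite [X in _ -> _ <= X <= _](_ : _ = a ord0 i +
    r * (a' ord0 i + r^-1 * (x ord0 i - a ord0 i) - a' ord0 i)); last first.
    by field; rewrite gt_eqF.
  by rewrite !lerD2l !ler_pM2l// !lerD2r.
apply: eq_eseriesr => k _; rewrite -EFinM; congr EFin.
rewrite (_ : r ^+ m.+1 = \prod_(i < m.+1) r); last by rewrite prodr_const card_ord.
rewrite /box_volume -big_split/=.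
by apply: eq_bigr => i _; rewrite !mxE; ring.
Qed.

(* [unit_cube_measure] is 1; the argument only needs it to be positive, and
   this follows from the finiteness of a median. *)
Definition unit_cube_measure : R := fine (mu (cube (0 : 'rV[R]_m.+1) 1)).

Lemma lebesgue_outer_cube a l : 0 < l ->
  mu (cube a l) = (unit_cube_measure * l ^+ m.+1)%:E.
Proof.
move=> l0.
have fin : mu (cube 0 1) \is a fin_num.
  rewrite ge0_fin_numE ?lebesgue_outer_ge0//.
  apply: le_lt_trans (lebesgue_outer_box _ _ _) (ltry _) => i.
  by rewrite !mxE lerDl.
rewrite mulrC EFinM fineK//; apply/eqP; rewrite eq_le; apply/andP; split.
  by rewrite -[l in (l ^+ _)]divr1; exact: lebesgue_outer_cube_le.
rewrite -lee_pdivlMl ?exprn_gt0// -exprVn -[l^-1]div1r.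
exact: lebesgue_outer_cube_le.
Qed.

Lemma unit_cube_measure_ge0 : 0 <= unit_cube_measure.
Proof. by rewrite fine_ge0// lebesgue_outer_ge0. Qed.

End boxes.

(** * The dyadic grid of a cube and a density theorem along it *)

Section dyadic_grid.
Context {R : realType} {m : nat} (a : 'rV[R]_m.+1) (l : R).
Hypothesis l0 : 0 < l.
Implicit Types (x y : 'rV[R]_m.+1) (k : nat).
Local Notation mu := (@lebesgue_outer R m).

Definition dyadic_side k : R := l / 2 ^+ k.

(** Integer coordinates of the half-open cell of generation [k] around [x]; lying in the same cell
    is equality of indices. *)
Definition grid_index k x : 'rV[int]_m.+1 :=
  \row_i Num.floor ((x ord0 i - a ord0 i) / dyadic_side k).

Definition grid_corner k x : 'rV[R]_m.+1 :=
  \row_i (a ord0 i + dyadic_side k * (grid_index k x ord0 i)%:~R).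

Definition grid_cube k x := cube (grid_corner k x) (dyadic_side k).

Definition grid_cell k x : set 'rV[R]_m.+1 :=
  [set y | grid_index k y = grid_index k x].

(** The grid cell of a point on an upper face of [cube a l] sticks out of the cube; these points are
    set aside as a null set. *)
Definition half_open_cube : set 'rV[R]_m.+1 :=
  [set x | forall i, a ord0 i <= x ord0 i < a ord0 i + l].

Lemma dyadic_side_gt0 k : 0 < dyadic_side k.
Proof. by rewrite divr_gt0// exprn_gt0. Qed.

Lemma dyadic_sideS k : dyadic_side k.+1 = dyadic_side k / 2.
Proof. by rewrite /dyadic_side exprSr invfM mulrA. Qed.

Lemma dyadic_side_small e : 0 < e -> exists K, forall k, (K <= k)%N -> dyadic_side k < e.
Proof.
move=> e0; exists (Num.bound (l / e)) => k Kk.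
rewrite ltr_pdivrMr ?exprn_gt0// mulrC -ltr_pdivrMr//.
have h : l / e < (Num.bound (l / e))%:R by rewrite archi_boundP// divr_ge0// ltW.
apply: lt_le_trans h _; rewrite -natrX ler_nat.
by apply: leq_trans Kk _; exact/ltnW/ltn_expl.
Qed.

Lemma grid_index_eqP k x y : grid_index k y = grid_index k x <->
  forall i, grid_corner k x ord0 i <= y ord0 i
            < grid_corner k x ord0 i + dyadic_side k.
Proof.
have h0 := dyadic_side_gt0 k.
have E i : (Num.floor ((y ord0 i - a ord0 i) / dyadic_side k) == grid_index k x ord0 i) =
  (grid_corner k x ord0 i <= y ord0 i < grid_corner k x ord0 i + dyadic_side k).
  rewrite floor_eq ler_pdivlMr// ltr_pdivrMr// lerBrDl ltrBlDl intrD mulrDl mul1r addrA.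
  by rewrite [grid_corner k x _ _]mxE [_ * dyadic_side k]mulrC.
split=> [yx i|h]; first by rewrite -E -yx mxE.
by apply/rowP => i; rewrite mxE; apply/eqP; rewrite E.
Qed.

Lemma grid_cell_sub_cube k x : grid_cell k x `<=` grid_cube k x.
Proof.
move=> y /grid_index_eqP h i; have /andP[h1 h2] := h i.
by rewrite !mxE in h1 h2 *; rewrite h1 ltW.
Qed.

Lemma grid_corner_bound k x i : grid_corner k x ord0 i <= x ord0 i
  < grid_corner k x ord0 i + dyadic_side k.
Proof. by move: i; exact/grid_index_eqP. Qed.

Lemma grid_cube_refl k x : grid_cube k x x.
Proof. exact: grid_cell_sub_cube. Qed.

Lemma grid_index_cube k x y : grid_index k y = grid_index k x ->
  grid_cube k y = grid_cube k x.
Proof. by move=> e; rewrite /grid_cube /grid_corner e. Qed.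

(* [floor (2 u)] is [2 floor u] or [2 floor u + 1] *)
Lemma grid_cornerS k x : exists e : 'I_m.+1 -> bool,
  grid_corner k.+1 x =
  grid_corner k x + \row_i (if e i then dyadic_side k / 2 else 0).
Proof.
have h0 := dyadic_side_gt0 k.
exists (fun i => grid_corner k x ord0 i + dyadic_side k / 2 <= x ord0 i).
apply/rowP => i; rewrite [RHS]mxE [in X in _ = _ + X]mxE.
have /andP[h1 h2] := grid_corner_bound k x i.
pose z := (grid_index k x ord0 i).
have zE : grid_corner k x ord0 i = a ord0 i + dyadic_side k * z%:~R by rewrite mxE.
have -> : grid_corner k.+1 x ord0 i = a ord0 i + dyadic_side k * 2^-1 *
    (Num.floor ((x ord0 i - a ord0 i) / (dyadic_side k / 2)))%:~R.
  by rewrite !mxE dyadic_sideS.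
case: ifPn => [h|]; last rewrite -ltNge => h.
  rewrite (@floor_def _ _ (2 * z + 1)) ?zE.
    by rewrite !intrD intrM; field.
  by rewrite ler_pdivlMr ?ltr_pdivrMr ?divr_gt0// !intrD intrM; apply/andP; split; lra.
rewrite (@floor_def _ _ (2 * z)) ?zE.
  by rewrite intrM; field.
by rewrite ler_pdivlMr ?ltr_pdivrMr ?divr_gt0// !intrD intrM; apply/andP; split; lra.
Qed.

Lemma cube_child_grid k x : cube_child (grid_cube k x) (grid_cube k.+1 x).
Proof.
have [e ce] := grid_cornerS k x.
exists (grid_corner k x), (dyadic_side k), e; split=> //.
  exact: dyadic_side_gt0.
by rewrite /grid_cube ce dyadic_sideS.
Qed.

Lemma grid_cubeS_sub k x : grid_cube k.+1 x `<=` grid_cube k x.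
Proof.
have [e ce] := grid_cornerS k x; have h0 := dyadic_side_gt0 k.
move=> y /(_ _)/andP => yx i; have [] := yx i.
rewrite ce dyadic_sideS [(_ + const_mx _) _ _]mxE [(_ + \row_j _) _ _]mxE.
rewrite [(_ + const_mx _) _ _]mxE [(\row_j _) _ _]mxE [const_mx _ _ _]mxE [const_mx _ _ _]mxE.
by case: ifP => _ ? ?; apply/andP; split; lra.
Qed.

Lemma grid_cube_sub j k x : (j <= k)%N -> grid_cube k x `<=` grid_cube j x.
Proof.
move=> /subnKC <-; elim: (k - j)%N => [|d IH]; rewrite ?addn0//.
by rewrite addnS; exact: subset_trans (grid_cubeS_sub _ _) IH.
Qed.

Lemma grid_indexS k x y :
  grid_index k.+1 y = grid_index k.+1 x -> grid_index k y = grid_index k x.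
Proof.
have h0 := dyadic_side_gt0 k.
have [e ce] := grid_cornerS k x; move=> /grid_index_eqP yx; apply/grid_index_eqP => i.
have := yx i; rewrite ce dyadic_sideS [(_ + \row_j _) _ _]mxE [(\row_j _) _ _]mxE.
by case: ifP => _ /andP[? ?]; apply/andP; split; lra.
Qed.

Lemma grid_index_le j k x y : (j <= k)%N ->
  grid_index k y = grid_index k x -> grid_index j y = grid_index j x.
Proof.
move=> /subnKC <-; elim: (k - j)%N => [|d IH]; rewrite ?addn0//.
by rewrite addnS => /grid_indexS.
Qed.

Lemma grid_cube0 x : half_open_cube x -> grid_cube 0 x = cube a l.
Proof.
move=> Qx; rewrite /grid_cube /dyadic_side expr0 divr1; congr cube.
apply/rowP => i; have /andP[h1 h2] := Qx i.
rewrite !mxE /dyadic_side expr0 divr1 (@floor_def _ _ 0) ?mulr0 ?addr0//.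
by rewrite divr_ge0 ?subr_ge0 ?(ltW l0)//= ltr_pdivrMr// mul1r ltrBlDl.
Qed.

Lemma dyadic_subcube_grid k x : half_open_cube x ->
  dyadic_subcube (cube a l) (grid_cube k x).
Proof.
move=> Qx; elim: k => [|k IH].
  by rewrite grid_cube0//; exact: dyadic_subcube_refl.
exact: dyadic_subcube_child IH (cube_child_grid k x).
Qed.

Lemma grid_cube_sub_cube k x : half_open_cube x -> grid_cube k x `<=` cube a l.
Proof. by move=> Qx; rewrite -(grid_cube0 x Qx); exact: grid_cube_sub. Qed.

(** An interior point can be moved by [e / 2] both ways along the diagonal without leaving the box,
    so none of its coordinates is extreme. *)
Lemma interior_box (b c : 'rV[R]_m.+1) x : interior (box b c) x ->
  forall i, b ord0 i < x ord0 i < c ord0 i.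
Proof.
move=> /nbhs_ballP[e /= e0 sub] i.
have shift (r : R) : `|r| < e -> b ord0 i <= x ord0 i + r <= c ord0 i.
  move=> re; suff /(_ i) : box b c (x + const_mx r) by rewrite !mxE.
  apply: sub; split=> // j j'; rewrite !mxE (ord1 j) /ball/= opprD addNKr normrN //.
have e2 : `|e / 2| < e by rewrite gtr0_norm ?divr_gt0//; lra.
have /andP[_ h1] := shift _ e2.
have /andP[h2 _] : b ord0 i <= x ord0 i + (- (e / 2)) <= c ord0 i.
  by apply: shift; rewrite normrN.
by apply/andP; split; lra.
Qed.

(** Cubes are closed while cells partition the space; passing to interiors turns overlap of cubes
    into equality of indices. *)
Lemma interior_grid_cube k x y :
  interior (grid_cube k x) y -> grid_index k y = grid_index k x.
Proof.
move=> /interior_box yx; apply/grid_index_eqP => i.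
by have := yx i; rewrite [(_ + const_mx _) _ _]mxE [const_mx _ _ _]mxE => /andP[/ltW -> ->].
Qed.

Definition half_open_box (b c : 'rV[R]_m.+1) : set 'rV[R]_m.+1 :=
  [set y | forall i, b ord0 i <= y ord0 i < c ord0 i].

Lemma measurable_half_open_box (b c : 'rV[R]_m.+1) :
  measurable (half_open_box b c : set (lebesgue_rV R m)).
Proof.
rewrite (_ : half_open_box b c = \bigcap_(i in [set: 'I_m.+1])
  (~` [set y : 'rV[R]_m.+1 | y ord0 i < b ord0 i]
   `&` [set y : 'rV[R]_m.+1 | y ord0 i < c ord0 i])).
  apply: fin_bigcap_measurable => // i _; apply: measurableI.
    exact: measurableC (measurable_halfspace_lt _ _).
  exact: measurable_halfspace_lt.
apply/seteqP; split=> y /=.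
  by move=> abx i _; have /andP[ax xb] := abx i; split=> //=; apply/negP; rewrite -leNgt.
by move=> abx i; have [/negP + xb] := abx i I; rewrite -leNgt => ->.
Qed.

Lemma grid_cellE k x : grid_cell k x = half_open_box (grid_corner k x)
  (grid_corner k x + const_mx (dyadic_side k)).
Proof.
apply/seteqP; split=> y.
  move=> /grid_index_eqP h i; have := h i.
  by rewrite [(_ + const_mx _) _ _]mxE [const_mx _ _ _]mxE.
move=> h; apply/grid_index_eqP => i; have := h i.
by rewrite [(_ + const_mx _) _ _]mxE [const_mx _ _ _]mxE.
Qed.

Lemma measurable_grid_cell k x : measurable (grid_cell k x : set (lebesgue_rV R m)).
Proof. by rewrite grid_cellE; exact: measurable_half_open_box. Qed.

Definition box_faces (b c : 'rV[R]_m.+1) : set 'rV[R]_m.+1 :=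
  [set x | box b c x /\ exists i, x ord0 i = b ord0 i \/ x ord0 i = c ord0 i].

Lemma lebesgue_outer_box_faces b c : mu (box_faces b c) = 0%E.
Proof.
(* The faces are indexed by natural numbers through [inord], as finite subadditivity expects a
   sequence. *)
pose F n := (box b c `&` [set x | x ord0 (inord n) = b ord0 (inord n)]) `|`
            (box b c `&` [set x | x ord0 (inord n) = c ord0 (inord n)]).
apply/eqP; rewrite eq_le lebesgue_outer_ge0 andbT.
apply: (@le_trans _ _ (mu (\big[setU/set0]_(i < m.+1) F i))).
  rewrite -bigcup_mkord; apply: le_lebesgue_outer => x [bcx [i xi]].
  exists i; [exact: ltn_ord | rewrite /F inord_val; by case: xi => xi; [left | right]].
apply: le_trans (outer_measure_subadditive mu F m.+1) _.
rewrite big1// => i _; apply/eqP; rewrite eq_le lebesgue_outer_ge0 andbT.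
apply: le_trans (outer_measureU2 mu _ _) _.
have h d : mu (box b c `&` [set x | x ord0 (inord i) = d]) = 0%E.
  exact: lebesgue_outer_boxI_hyperplane.
by rewrite [X in (X + _)%E]h [X in (_ + X)%E]h adde0.
Qed.

Lemma boxD_half_open b c : box b c `\` half_open_box b c `<=` box_faces b c.
Proof.
move=> x [bcx /existsNP[i /negP nlt]]; split=> //; exists i; right.
have /andP[bx xc] := bcx i; move: nlt; rewrite bx/= -leNgt => cx.
by apply/eqP; rewrite eq_le xc cx.
Qed.

Lemma lebesgue_outer_half_open_box b c : mu (half_open_box b c) = mu (box b c).
Proof.
apply/eqP; rewrite eq_le; apply/andP; split.
  by apply: le_lebesgue_outer => x bcx i; have /andP[-> /ltW->] := bcx i.
apply: (@le_trans _ _ (mu (half_open_box b c `|` box_faces b c))).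
  apply: le_lebesgue_outer => x bcx.
  have [|nx] := pselect (half_open_box b c x); first by left.
  by right; apply: boxD_half_open; split.
apply: le_trans (outer_measureU2 mu _ _) _.
by rewrite [X in (_ + X)%E]lebesgue_outer_box_faces adde0.
Qed.

Lemma lebesgue_outer_grid_cell k x : mu (grid_cell k x) = mu (grid_cube k x).
Proof. by rewrite grid_cellE lebesgue_outer_half_open_box. Qed.

(** Off the faces every coordinate of [x] keeps a positive distance from both ends; a grid cube
    around [x] with side below all these distances fits. *)
Lemma grid_cube_in_box b c x : box b c x -> ~ box_faces b c x ->
  exists k, grid_cube k x `<=` box b c.
Proof.
move=> bcx nf.
have lt i : b ord0 i < x ord0 i < c ord0 i.
  have /andP[bx xc] := bcx i; rewrite !lt_neqAle bx xc !andbT.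
  apply/andP; split; apply/eqP => e; apply: nf; split=> //; exists i; [left|right] => //.
have /choice[K KP] i : exists K, forall k, (K <= k)%N ->
    dyadic_side k < Num.min (x ord0 i - b ord0 i) (c ord0 i - x ord0 i).
  apply: dyadic_side_small; have /andP[? ?] := lt i.
  by rewrite lt_min !subr_gt0; apply/andP.
exists (\max_i K i)%N => y xy i.
have /= := KP i _ (leq_bigmax i); rewrite lt_min => /andP[h1 h2].
have := xy i; rewrite [(_ + const_mx _) _ _]mxE [const_mx _ _ _]mxE => /andP[h3 h4].
have /andP[h5 h6] := grid_corner_bound (\max_i K i)%N x i.
by apply/andP; split; lra.
Qed.

(* Vitali-type covering by the maximal dyadic cubes lying in one of the boxes;
   the faces of the boxes are null, so every other point of [N] is in one. *)
Lemma dyadic_density_cover (N : set 'rV[R]_m.+1) (theta : R) B :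
  0 < theta ->
  (forall k x, N x -> (mu (N `&` grid_cube k x) <= theta%:E * mu (grid_cube k x))%E) ->
  box_cover N B ->
  (mu N <= theta%:E * \sum_(j <oo) (box_volume (B j).1 (B j).2)%:E)%E.
Proof.
move=> theta0 dN [le_B NB].
pose Z := \bigcup_j box_faces (B j).1 (B j).2.
have Z0 : mu Z = 0%E.
  apply/eqP; rewrite eq_le lebesgue_outer_ge0 andbT.
  apply: le_trans (outer_measure_sigma_subadditive mu _) _.
  by rewrite eseries0// => j _ _; exact: lebesgue_outer_box_faces.
pose inB k x := exists j, grid_cube k x `<=` box (B j).1 (B j).2.
(* Maximality of a cube means that its generation is the least one for which it fits in a box. *)
pose first k x := inB k x /\ forall i, (i < k)%N -> ~ inB i x.
have first_cell k x y : grid_index k y = grid_index k x -> first k x -> first k y.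
  move=> yx [kx ix]; split; first by rewrite /inB (grid_index_cube k x y yx).
  move=> i ik; rewrite /inB (grid_index_cube i x y); first exact: ix.
  by apply: (grid_index_le i k) yx; exact: ltnW.
have first_inj k k' x : first k x -> first k' x -> k = k'.
  by move=> [k1 k2] [k1' k2']; case: (ltngtP k k') => // [/k2'|/k2].
(* The selected cells as a sequence: [n] encodes generation and index, and [T n] is empty when [n]
   encodes no selected cell. *)
pose T n := [set y | exists x k, [/\ N x, first k x,
  pickle (k, grid_index k x) = n & grid_index k y = grid_index k x]].
have Tcell n : T n = set0 \/ exists x k, [/\ N x, first k x & T n = grid_cell k x].
  have [[y [x [k [Nx kx xn yx]]]]|/set0P/negP/negPn/eqP] := pselect (T n !=set0); last by left.
  right; exists x, k; split=> //; apply/seteqP; split=> z.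
    move=> [x' [k' [Nx' kx' xn' zx']]].
    by have [kk xx] := pcan_inj pickleK (etrans xn' (esym xn)); subst k';
      rewrite /grid_cell/= zx'.
  by move=> zx; exists x, k.
have mT n : measurable (T n : set (lebesgue_rV R m)).
  by have [->|[x [k [_ _ ->]]]] := Tcell n; [exact: measurable0 | exact: measurable_grid_cell].
have tT : trivIset setT T.
  apply/trivIsetP => n n' _ _ nn'; apply/seteqP; split=> // y.
  move=> [[x [k [_ kx xn yx]]] [x' [k' [_ kx' xn' yx']]]].
  have kk := first_inj _ _ _ (first_cell _ _ _ yx kx) (first_cell _ _ _ yx' kx'); subst k'.
  by move/eqP: nn'; apply; rewrite -xn -xn' -yx -yx'.
have NT : N `<=` Z `|` \bigcup_n (N `&` T n).
  move=> x Nx; have [|nZ] := pselect (Z x); [by left | right].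
  have [j _ Bjx] := NB x Nx.
  have [|k kx] := grid_cube_in_box _ _ x Bjx; first by move=> ?; apply: nZ; exists j.
  have ex : exists k, `[< inB k x >] by exists k; apply/asboolP; exists j.
  case: (ex_minnP ex) => k' /asboolP k'x mink'.
  exists (pickle (k', grid_index k' x)) => //; split=> //; exists x, k'; split=> //.
  by split=> // i ik' /asboolP/mink'; rewrite leqNgt ik'.
have TB : \bigcup_n T n `<=` \bigcup_j box (B j).1 (B j).2.
  move=> y [n _ [x [k [_ [[j jx] _] _ yx]]]]; exists j => //.
  by apply: jx; exact: grid_cell_sub_cube.
apply: le_trans (le_lebesgue_outer NT) _.
apply: le_trans (outer_measureU2 mu _ _) _; rewrite [X in (X + _)%E]Z0 add0e.
apply: le_trans (outer_measure_sigma_subadditive mu _) _.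
apply: (@le_trans _ _ (\sum_(n <oo) (theta%:E * mu (T n)))%E).
  apply: lee_nneseries => [n _ _|n _]; first exact: lebesgue_outer_ge0.
  have [->|[x [k [Nx _ ->]]]] := Tcell n.
    by rewrite setI0 [X in (X <= _)%E]lebesgue_outer0 [X in (_ * X)%E]lebesgue_outer0 mule0.
  rewrite lebesgue_outer_grid_cell; apply: le_trans (dN k x Nx).
  by apply: le_lebesgue_outer => y [Ny /grid_cell_sub_cube].
rewrite nneseriesZl; last by move=> n _; exact: lebesgue_outer_ge0.
rewrite lee_pmul2l//.
(* Disjointness of the cells turns the sum of their measures into the measure of their union, which
   the boxes cover. *)
rewrite -(measure_semi_bigcup (@lebesgue_measure_rV R m))//; last exact: bigcup_measurable.
apply: le_trans (le_lebesgue_outer TB) _.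
apply: le_trans (outer_measure_sigma_subadditive mu _) _.
apply: lee_nneseries => [j _ _|j _]; first exact: lebesgue_outer_ge0.
exact: lebesgue_outer_box.
Qed.

(** Taking the infimum over covers in [dyadic_density_cover] gives [mu N <= theta * mu N], which
    forces the finite value [mu N] to vanish. *)
Lemma dyadic_density (N : set 'rV[R]_m.+1) (theta : R) :
  0 < theta < 1 -> (mu N < +oo)%E ->
  (forall k x, N x -> (mu (N `&` grid_cube k x) <= theta%:E * mu (grid_cube k x))%E) ->
  mu N = 0%E.
Proof.
move=> /andP[theta0 theta1] Noo dN.
have : (mu N <= theta%:E * mu N)%E.
  rewrite -lee_pdivrMl//; apply: le_ereal_inf_tmp => _ [B NB <-].
  by rewrite lee_pdivrMl//; exact: dyadic_density_cover.
have Nfin : mu N \is a fin_num by rewrite ge0_fin_numE ?lebesgue_outer_ge0.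
have := lebesgue_outer_ge0 N; rewrite -(fineK Nfin) -EFinM !lee_fin => N0 Nt.
congr EFin; apply/eqP; rewrite eq_le N0 andbT.
by rewrite -subr_ge0 -[X in _ - X]mul1r -mulrBl in Nt; rewrite nmulr_rge0 ?subr_lt0 in Nt.
Qed.

End dyadic_grid.

(** * Real functions with small local jumps *)

Section jumps.
Context {R : realType} (c : R -> R) (b : R).
Hypothesis b0 : 0 <= b.

(** Continuity up to an error [b]; in the application [b] is twice the radius of concentration. *)
Definition small_jumps (g : R -> R) (lo hi : R) := forall v, lo <= v <= hi ->
  exists2 eta, 0 < eta &
    forall w, lo <= w <= hi -> `|w - v| < eta -> `|g w - g v| <= b.

(** An intermediate value theorem up to jumps. Let [w] be the supremum of the points where [g] is at
    most [g lo + b]; there [g] has grown by at most [2 * b], and either [w] or a point just after it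
    is the required [v]. *)
Lemma small_jumps_between (g : R -> R) (lo hi : R) : lo <= hi -> small_jumps g lo hi ->
  g lo + 3 * b < g hi ->
  exists v, [/\ lo < v < hi, b < g v - g lo & b < g hi - g v].
Proof.
move=> lohi loc jump.
pose S := [set v | lo <= v <= hi /\ g v <= g lo + b].
have Slo : S lo by split; rewrite ?lexx// lerDl.
have Shi : ubound S hi by move=> v [/andP[]].
have hS : has_sup S by split; [exists lo | exists hi].
pose w := sup S.
have w_in : lo <= w <= hi.
  by rewrite (ub_le_sup hS.2)//= ge_sup//; exists lo.
have [eta eta0 etaP] := loc w w_in.
have [v Sv vw] := sup_adherent eta0 hS.
have vw' : v <= w by exact: (ub_le_sup hS.2).
have gvw : `|g v - g w| <= b.
  apply: etaP; first by case: Sv.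
  by rewrite distrC ger0_norm ?subr_ge0// ltrBlDr -ltrBlDl; move: vw; rewrite /w; lra.
have gv : g v <= g lo + b by case: Sv.
have := gvw; rewrite ler_norml => /andP[gvw1 gvw2].
have gw2 : g w <= g lo + 2 * b by lra.
have strict v0 : lo <= v0 <= hi -> b < g v0 - g lo -> b < g hi - g v0 -> lo < v0 < hi.
  move=> /andP[lv vh] h1 h2; rewrite !lt_neqAle lv vh !andbT.
  by apply/andP; split; apply/eqP => e; subst v0; lra.
have [gw1|gw1] := ltP (g lo + b) (g w).
  by exists w; split; [apply: strict|..]; lra.
have whi : w < hi.
  rewrite lt_neqAle; have /andP[_ ->] := w_in; rewrite andbT.
  by apply/eqP => e; move: gw1; rewrite e; lra.
(* Here [w] still satisfies [g w <= g lo + b]; a point [z] slightly beyond it does not, and exceeds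
   [g w] by at most [b]. *)
pose z := Num.min hi (w + eta / 2).
have wz : w < z by rewrite /z lt_min whi /= ltrDl divr_gt0.
have /andP[lw _] := w_in.
have zz : lo <= z <= hi by rewrite (le_trans lw (ltW wz)) ge_min lexx.
have gz : g lo + b < g z.
  rewrite ltNge; apply/negP => h; have : z <= w by apply: (ub_le_sup hS.2); split.
  by rewrite leNgt wz.
have : `|g z - g w| <= b.
  apply: etaP => //; rewrite gtr0_norm ?subr_gt0//.
  have : z <= w + eta / 2 by rewrite /z ge_min lexx orbT.
  lra.
rewrite ler_norml => /andP[gz1 gz2].
by exists z; split; [apply: strict|..]; lra.
Qed.

Lemma small_jumpsN g lo hi : small_jumps g lo hi -> small_jumps (\- g) lo hi.
Proof.
move=> loc v /loc[eta eta0 etaP]; exists eta => // w wI wv.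
by rewrite /= -opprD normrN; exact: etaP.
Qed.

Lemma small_jumps_sub g lo hi lo' hi' : lo <= lo' -> hi' <= hi ->
  small_jumps g lo hi -> small_jumps g lo' hi'.
Proof.
move=> ll hh loc v /andP[v1 v2].
have [|eta eta0 etaP] := loc v; first by rewrite (le_trans ll v1) (le_trans v2 hh).
exists eta => // w /andP[w1 w2]; apply: etaP.
by rewrite (le_trans ll w1) (le_trans w2 hh).
Qed.

(** A larger variation would produce [v] strictly between, with value far from both end values; then
    [lo + v < hi <= 2 * lo] contradicts [lo < v]. *)
Lemma small_jumps_doubling lo hi : lo <= hi -> hi <= 2 * lo ->
  small_jumps c lo hi ->
  (forall v, lo < v < hi -> b < `|c v - c lo| -> b < `|c hi - c v| ->
     b < `|c hi - c lo| -> lo + v < hi) ->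
  `|c hi - c lo| <= 3 * b.
Proof.
move=> lohi hi2 loc sep; rewrite leNgt; apply/negP => big.
suff [v [/andP[v1 v2] h1 h2]] : exists v,
    [/\ lo < v < hi, b < `|c v - c lo| & b < `|c hi - c v|].
  have : lo + v < hi by apply: sep => //; [rewrite v1 | move: b0 big; lra].
  by lra.
have abs (x y : R) : x <= y -> b < x -> b < y by lra.
move: big; rewrite ltr_normr => /orP[big|big].
  have [|v [vI h1 h2]] := small_jumps_between c lo hi lohi loc; first by lra.
  by exists v; split=> //; [apply: abs h1 | apply: abs h2]; exact: ler_norm.
have [|v [vI h1 h2]] := small_jumps_between (\- c) lo hi lohi (small_jumpsN _ _ _ loc);
  first by rewrite /=; lra.
rewrite /= in h1 h2; exists v; split=> //; rewrite -normrN.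
  by apply: abs h1; apply: le_trans (ler_norm _); lra.
by apply: abs h2; apply: le_trans (ler_norm _); lra.
Qed.

(** Each of the [n] doublings from [1] to [2 ^+ n] contributes at most [3 * b]. *)
Lemma small_jumps_pow2 n : small_jumps c 1 (2 ^+ n) ->
  (forall u v w, 1 <= u -> u < v < w -> w <= 2 ^+ n -> b < `|c v - c u| ->
     b < `|c w - c v| -> b < `|c w - c u| -> u + v < w) ->
  `|c (2 ^+ n) - c 1| <= 3 * b * n%:R.
Proof.
elim: n => [|n IH] loc sep; first by rewrite expr0 subrr normr0 mulr0.
have le2 : 2 ^+ n <= 2 ^+ n.+1 :> R by rewrite exprS; have : 0 < 2 ^+ n :> R by []; lra.
have le1 : 1 <= 2 ^+ n :> R by rewrite exprn_ege1// ler1n.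
have IHn : `|c (2 ^+ n) - c 1| <= 3 * b * n%:R.
  apply: IH; first exact: small_jumps_sub loc.
  by move=> u v w u1 uvw w2; apply: sep => //; exact: le_trans le2.
have D : `|c (2 ^+ n.+1) - c (2 ^+ n)| <= 3 * b.
  apply: small_jumps_doubling => //; first by rewrite exprS.
    exact: small_jumps_sub loc.
  by move=> v vI h1 h2 h3; apply: sep.
rewrite -[n.+1%:R]natr1 mulrDr mulr1.
have -> : c (2 ^+ n.+1) - c 1 = (c (2 ^+ n) - c 1) + (c (2 ^+ n.+1) - c (2 ^+ n)) by ring.
by apply: le_trans (ler_normD _ _) _; apply: lerD.
Qed.

End jumps.

(** * Concentration around a constant and the median *)

Section median.
Context {R : realType} {m : nat}.
Implicit Types (P Q A : set 'rV[R]_m.+1) (f : 'rV[R]_m.+1 -> R) (b c s t : R).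
Local Notation mu := (@lebesgue_outer R m).

Definition far f b c : set 'rV[R]_m.+1 := [set y | b < `|f y - c|].

(** Strictness is what leaves [f] close to [c] on more than half of [P] even when [s = 1 / 2]. *)
Definition concentrated s b f P c := (mu (P `&` far f b c) < s%:E * mu P)%E.

(** The infimum over constants may not be attained, hence a radius [b] strictly above [beta]. *)
Lemma local_oscillation_concentrated s f P (beta b : R) :
  (local_oscillation s f P <= beta%:E)%E -> beta < b ->
  exists c, concentrated s b f P c.
Proof.
move=> osc betab.
have : (local_oscillation s f P < b%:E)%E by apply: le_lt_trans osc _; rewrite lte_fin.
move=> /ereal_inf_lt[_ [c _ <-]] /ereal_inf_lt[_ [alpha [alpha0 h] <-]].
rewrite lte_fin => alphab; exists c; apply: le_lt_trans h.
by apply: le_lebesgue_outer => y [Py]; split=> //; exact: lt_trans alphab _.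
Qed.

(** If some [M > c + b] were admissible, [P] would be the union of a set of measure at most [t * v]
    and a far set of measure less than [s * v], too small together. Conversely [c - b] is
    admissible, since points below it are far and [s <= t]. *)
Lemma maximal_median_concentrated s t b f P c (v : R) :
  0 < v -> mu P = v%:E -> s <= t <= 1 - s -> concentrated s b f P c ->
  exists2 r, maximal_median f t P = r%:E & `|r - c| <= b.
Proof.
move=> v0 Pv /andP[st ts] conc.
have conc' : (mu (P `&` far f b c) < (s * v)%:E)%E by rewrite EFinM -Pv.
have ub : (maximal_median f t P <= (c + b)%:E)%E.
  apply: ge_ereal_sup => _ [M /= MP <-]; rewrite lee_fin leNgt; apply/negP => cM.
  suff : (mu P < v%:E)%E by rewrite Pv ltxx.
  apply: (@le_lt_trans _ _ (mu ((P `&` [set y | f y < M]) `|` (P `&` far f b c)))).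
    apply: le_lebesgue_outer => y Py.
    have [fM|Mf] := ltP (f y) M; [by left | right; split=> //].
    rewrite /far /= ltr_normr; apply/orP; left; lra.
  apply: le_lt_trans (outer_measureU2 mu _ _) _.
  apply: (@lt_le_trans _ _ ((t * v)%:E + (s * v)%:E)%E).
    apply: lee_ltD => //; last by rewrite EFinM -Pv.
    rewrite ge0_fin_numE ?lebesgue_outer_ge0//; apply: le_lt_trans MP _.
    by rewrite [X in (_ * X)%E]Pv -EFinM ltry.
  by rewrite -EFinD lee_fin -mulrDl ler_piMl ?(ltW v0)//; lra.
have lb : ((c - b)%:E <= maximal_median f t P)%E.
  apply: ereal_sup_ubound; exists (c - b) => //=.
  apply: le_trans (ltW (lt_le_trans conc' _)); last first.
    by rewrite [X in (_ * X)%E]Pv -EFinM lee_fin ler_pM2r.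
  apply: le_lebesgue_outer => y [Py /= fy]; split=> //.
  by rewrite /far/= ltr_normr; apply/orP; right; lra.
case: (maximal_median f t P) lb ub => [r| |] //; rewrite !lee_fin => h1 h2.
by exists r => //; rewrite ler_norml; apply/andP; split; lra.
Qed.

Lemma concentrated_near s b f P c (v : R) : mu P = v%:E -> s <= 1 / 2 -> 0 <= v ->
  concentrated s b f P c -> ((v / 2)%:E < mu (P `\` far f b c))%E.
Proof.
move=> Pv s2 v0 conc; rewrite ltNge; apply/negP => near.
have : (v%:E < v%:E)%E; last by rewrite ltxx.
rewrite -{1}Pv; apply: (@le_lt_trans _ _ (mu ((P `\` far f b c) `|` (P `&` far f b c)))).
  by rewrite setUC setUIDK.
apply: le_lt_trans (outer_measureU2 mu _ _) _.
apply: (@lt_le_trans _ _ ((v / 2)%:E + (s * v)%:E)%E).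
  apply: lee_ltD => //; last by rewrite EFinM -Pv.
  by rewrite ge0_fin_numE ?lebesgue_outer_ge0//; apply: le_lt_trans near (ltry _).
rewrite -EFinD lee_fin; have : s * v <= 1 / 2 * v by rewrite ler_wpM2r.
lra.
Qed.

Lemma near_disjoint f b c c' y : 2 * b < `|c - c'| -> ~ far f b c y -> far f b c' y.
Proof.
move=> cc /negP; rewrite /far /= -leNgt => h1; rewrite ltNge; apply/negP => h2.
have : `|c - c'| <= `|f y - c'| + `|f y - c|.
  by rewrite (_ : c - c' = (f y - c') - (f y - c)) ?ler_normB//; ring.
lra.
Qed.

End median.

(** * Constants along the cubes from a child to its parent *)

Section oscillation_chain.
Context {R : realType} {m : nat} (Q : set 'rV[R]_m.+1) (f : 'rV[R]_m.+1 -> R).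
Hypothesis mQ : measurable (Q : set (lebesgue_rV R m)).
Hypothesis mf : measurable_fun (Q : set (lebesgue_rV R m)) (f : lebesgue_rV R m -> R).
Local Notation mu := (@lebesgue_outer R m).
Local Notation kappa := (@unit_cube_measure R m).
Implicit Types (P : set 'rV[R]_m.+1) (b c : R).

Lemma measurable_far b c : measurable (Q `&` far f b c : set (lebesgue_rV R m)).
Proof.
have -> : far f b c = f @^-1` (`]-oo, (c - b)[ `|` `](c + b), +oo[).
  apply/seteqP; split=> y; rewrite /far /= !in_itv /= andbT ltr_normr.
    by move=> /orP[h|h]; [right | left]; lra.
  by case=> h; apply/orP; [right | left]; lra.
by apply: mf => //; apply: measurableU; exact: measurable_itv.
Qed.

(** The Caratheodory property of the far set within [Q] splits [P] into one piece containing [G] and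
    another containing [G']. *)
Lemma lebesgue_outer_near_far b c P G G' : P `<=` Q -> G `<=` P -> G' `<=` P ->
  (forall y, G y -> ~ far f b c y) -> G' `<=` far f b c ->
  (mu G + mu G' <= mu P)%E.
Proof.
move=> PQ GP G'P Gn G'f.
have -> : mu P = (mu (P `&` ~` (Q `&` far f b c)) + mu (P `&` (Q `&` far f b c)))%E.
  by rewrite addeC; exact: (measurable_far b c : mu.-caratheodory _).
apply: leeD; apply: le_lebesgue_outer => y Gy; split=> //.
- exact: GP.
- by move=> [_]; exact: Gn.
- exact: G'P.
- by split; [exact/PQ/G'P | exact: G'f].
Qed.

Lemma concentrated_separated2 b P P1 P2 c1 c2 :
  P `<=` Q -> P1 `<=` P -> P2 `<=` P -> 2 * b < `|c1 - c2| ->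
  (mu (P1 `\` far f b c1) + mu (P2 `\` far f b c2) <= mu P)%E.
Proof.
move=> PQ P1P P2P c12; apply: (@lebesgue_outer_near_far b c1) => //.
- by move=> y [/P1P].
- by move=> y [/P2P].
- by move=> y [].
- by move=> y [_]; apply: near_disjoint; rewrite distrC.
Qed.

(** Near sets of separated constants are disjoint: the second is first split from the third, then
    the first from their union. *)
Lemma concentrated_separated3 b P P1 P2 P3 c1 c2 c3 :
  P `<=` Q -> P1 `<=` P -> P2 `<=` P -> P3 `<=` P ->
  2 * b < `|c1 - c2| -> 2 * b < `|c2 - c3| -> 2 * b < `|c1 - c3| ->
  (mu (P1 `\` far f b c1) + (mu (P2 `\` far f b c2) + mu (P3 `\` far f b c3))
    <= mu P)%E.
Proof.
move=> PQ P1P P2P P3P c12 c23 c13.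
pose G := (P2 `\` far f b c2) `|` (P3 `\` far f b c3).
apply: (@le_trans _ _ (mu (P1 `\` far f b c1) + mu G)%E).
  apply: leeD => //; apply: (@lebesgue_outer_near_far b c2).
  - by move=> y [[/P2P/PQ]|[/P3P/PQ]].
  - exact: subsetUl.
  - exact: subsetUr.
  - by move=> y [].
  - by move=> y [_]; apply: near_disjoint; rewrite distrC.
apply: (@lebesgue_outer_near_far b c1) => //.
- by move=> y [/P1P].
- by move=> y [[/P2P]|[/P3P]].
- by move=> y [].
- by move=> y [[_]|[_]]; apply: near_disjoint; rewrite distrC.
Qed.

Variables (q : 'rV[R]_m.+1) (h : R) (e : 'I_m.+1 -> bool).
Hypothesis h0 : 0 < h.
Hypothesis kappa0 : 0 < kappa.

Let n := m.+1.

(* Interpolates between a child ([v = 1]) and its parent ([v = 2 ^+ n]),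
   parametrized so that the volume is proportional to [v]. *)
Definition inter_cube (v : R) : set 'rV[R]_m.+1 :=
  cube (q + \row_i (if e i then h * (2 - v `^ n%:R^-1) else 0)) (h * v `^ n%:R^-1).

Lemma nroot_exp (v : R) : 0 <= v -> (v `^ n%:R^-1) ^+ n = v.
Proof.
by move=> v0; rewrite -powR_mulrn ?powR_ge0// -powRrM mulVf ?pnatr_eq0// powRr1.
Qed.

Lemma nroot_le (u v : R) : 0 <= u -> u <= v -> u `^ n%:R^-1 <= v `^ n%:R^-1.
Proof.
move=> u0 uv; apply: ge0_ler_powR; rewrite ?nnegrE ?invr_ge0//.
exact: le_trans uv.
Qed.

Lemma nroot2 : (2 ^+ n) `^ n%:R^-1 = 2 :> R.
Proof. by rewrite -powR_mulrn// -powRrM mulfV ?pnatr_eq0// powRr1. Qed.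

Lemma inter_cube1 :
  inter_cube 1 = cube (q + \row_i (if e i then h else 0)) h.
Proof.
rewrite /inter_cube powR1 mulr1; congr cube; congr (_ + _).
by apply/rowP => i; rewrite !mxE; case: ifP => // _; ring.
Qed.

Lemma inter_cube_pow2 : inter_cube (2 ^+ n) = cube q (2 * h).
Proof.
rewrite /inter_cube nroot2; congr cube; last exact: mulrC.
by apply/rowP => i; rewrite !mxE; case: ifP => // _; ring.
Qed.

(** In each direction one face is fixed, the upper one if [e i] and the lower one otherwise, while
    the opposite face moves outward. *)
Lemma inter_cube_sub u v : 0 <= u -> u <= v ->
  inter_cube u `<=` inter_cube v.
Proof.
move=> u0 /(nroot_le _ _ u0) uv y uy i; have := uy i; rewrite !mxE.
have : h * u `^ n%:R^-1 <= h * v `^ n%:R^-1 by rewrite ler_pM2l.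
by case: ifP => _ huv /andP[h1 h2]; apply/andP; split; lra.
Qed.

Lemma lebesgue_outer_inter_cube v : 0 < v ->
  mu (inter_cube v) = (kappa * h ^+ n * v)%:E.
Proof.
move=> v0; rewrite lebesgue_outer_cube ?mulr_gt0 ?powR_gt0//.
by rewrite exprMn nroot_exp ?ltW// mulrA.
Qed.

Lemma is_cube_inter_cube v : 0 < v -> is_cube (inter_cube v).
Proof. by move=> v0; do 2!eexists; split; last by []; rewrite mulr_gt0 ?powR_gt0. Qed.

(** Disjoint near sets, each filling more than half of its cube, supply both hypotheses of
    [small_jumps_pow2], with [2 * b] for [b]. *)
Lemma concentrated_inter_cubes (b : R) (c : R -> R) : 0 < b ->
  inter_cube (2 ^+ n) `<=` Q ->
  (forall v, 1 <= v <= 2 ^+ n -> concentrated (1 / 2) b f (inter_cube v) (c v)) ->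
  `|c (2 ^+ n) - c 1| <= 6 * b * n%:R.
Proof.
move=> b0 subQ conc.
pose K := kappa * h ^+ n.
have K0 : 0 < K by rewrite mulr_gt0// exprn_gt0.
have volE v : 1 <= v -> mu (inter_cube v) = (K * v)%:E.
  by move=> v1; rewrite lebesgue_outer_inter_cube//; exact: lt_le_trans v1.
have sub u v : 1 <= u -> u <= v -> inter_cube u `<=` inter_cube v.
  by move=> u1; apply: inter_cube_sub; exact: le_trans u1.
have subQ' v : 1 <= v <= 2 ^+ n -> inter_cube v `<=` Q.
  by move=> /andP[v1 v2]; apply: subset_trans subQ; exact: sub.
have near v : 1 <= v <= 2 ^+ n ->
    exists2 g, K * v / 2 < g & mu (inter_cube v `\` far f b (c v)) = g%:E.
  move=> vI; have /andP[v1 v2] := vI.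
  have := concentrated_near _ _ _ _ _ _ (volE v v1) (lexx _) _ (conc v vI).
  have : (mu (inter_cube v `\` far f b (c v)) <= (K * v)%:E)%E.
    by rewrite -volE//; apply: le_lebesgue_outer => y [].
  case: (mu (_ `\` _)) => [g| |] // _.
  - by rewrite lte_fin => hg; exists g => //; apply: hg; rewrite mulr_ge0 ?(ltW K0)//; lra.
  - move=> hg; suff : ((K * v / 2)%:E < -oo :> \bar R)%E by [].
    by apply: hg; rewrite mulr_ge0 ?(ltW K0)//; lra.
have -> : 6 * b = 3 * (2 * b) by ring.
apply: small_jumps_pow2; first lra.
- move=> v vI; have [g gv gE] := near v vI; have /andP[v1 v2] := vI.
  (* The excess of the near set over half of its cube, as a length in [v]. For [w] closer than this,
     two disjoint near sets would not fit in the larger cube. *)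
  exists ((g - K * v / 2) / K) => [|w wI]; first by rewrite divr_gt0// subr_gt0.
  rewrite ltr_pdivlMr// => wv; have [g' gw gE'] := near w wI; have /andP[w1 w2] := wI.
  rewrite leNgt; apply/negP => jump.
  have key z : 1 <= z <= 2 ^+ n -> v <= z -> w <= z -> g + g' <= K * z.
    move=> zI vz wz; have /andP[z1 z2] := zI.
    rewrite -lee_fin EFinD -gE -gE' -volE//.
    by apply: concentrated_separated2 => //; [exact: subQ'|exact: sub|exact: sub|rewrite distrC].
  have [vw|wv'] := leP v w.
    have := key w wI vw (lexx _); move: wv; rewrite ger0_norm ?subr_ge0// => wv.
    by rewrite mulrBl in wv; lra.
  have := key v vI (lexx _) (ltW wv'); move: wv; rewrite ltr0_norm ?subr_lt0// => wv.
  by rewrite opprB mulrBl in wv; lra.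
(* Three disjoint near sets, of measure above [K * u / 2], [K * v / 2] and [K * w / 2], fit in a
   cube of measure [K * w]. *)
- move=> u v w u1 /andP[uv vw] w2 h1 h2 h3.
  have v1 : 1 <= v by lra. have w1 : 1 <= w by lra.
  have [|gu gu1 guE] := near u; first by rewrite u1 /=; lra.
  have [|gv gv1 gvE] := near v; first by rewrite v1 /=; lra.
  have [|gw gw1 gwE] := near w; first by rewrite w1.
  have : gu + (gv + gw) <= K * w.
    rewrite -lee_fin !EFinD -guE -gvE -gwE -volE//.
    apply: concentrated_separated3; rewrite 1?distrC//.
    - by apply: subQ'; rewrite w1.
    - by apply: sub => //; lra.
    - by apply: sub => //; lra.
  move=> sum; have : K * (u + v) < K * w by rewrite mulrDr; lra.
  by rewrite ltr_pM2l.
Qed.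

End oscillation_chain.

(** * Comparison of the medians of a cube and its child *)

Section median_child.
Context {R : realType} {m : nat}.
Implicit Types (P Q : set 'rV[R]_m.+1) (f : 'rV[R]_m.+1 -> R).
Local Notation mu := (@lebesgue_outer R m).

Lemma maximal_median_child P P' Q f (s t beta : R) y :
  0 < unit_cube_measure (R := R) (m := m) ->
  measurable (Q : set (lebesgue_rV R m)) ->
  measurable_fun (Q : set (lebesgue_rV R m)) (f : lebesgue_rV R m -> R) ->
  0 < beta -> s <= 1 / 2 -> 1 / 2 <= t <= 1 - s ->
  cube_child P P' -> P `<=` Q -> P' y ->
  (local_sharp_maximal s Q f y <= beta%:E)%E ->
  exists r r', [/\ maximal_median f t P = r%:E, maximal_median f t P' = r'%:E &
    `|r' - r| <= 10 * m.+1%:R * beta].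
Proof.
move=> kappa0 mQ mf beta0 s2 /andP[t2 ts] [q [l [e [l0 PE P'E]]]] PQ P'y sharp.
have h0 : 0 < l / 2 by rewrite divr_gt0.
have P'1 : P' = inter_cube q (l / 2) e 1 by rewrite inter_cube1.
have P2 : P = inter_cube q (l / 2) e (2 ^+ m.+1).
  by rewrite inter_cube_pow2 PE; congr cube; field.
(* A radius strictly above [beta], chosen so that [8 * n * b = 10 * n * beta] for [n = m.+1]. *)
pose b := 5 / 4 * beta.
have le1 : 1 <= 2 ^+ m.+1 :> R by rewrite exprn_ege1// ler1n.
(* The range of [v] is a premise under the existential, so that [choice] yields a total function;
   outside the range its value is arbitrary. *)
have conc v : exists c, 1 <= v <= 2 ^+ m.+1 -> concentrated s b f (inter_cube q (l / 2) e v) c.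
  have [/andP[v1 v2]|nv] := boolP (1 <= v <= 2 ^+ m.+1); last by exists 0.
  have [||c cP] := @local_oscillation_concentrated _ _ s f (inter_cube q (l / 2) e v) beta b.
  - apply: le_trans sharp; apply: ereal_sup_ubound.
    exists (inter_cube q (l / 2) e v) => //; split.
    + by apply: is_cube_inter_cube => //; lra.
    + by apply: subset_trans PQ; rewrite P2; apply: inter_cube_sub => //; lra.
    + by move: P'y; rewrite P'1; apply: inter_cube_sub => //; lra.
  - by rewrite /b; lra.
  - by exists c.
have [c cP] := choice conc.
have c12 : `|c (2 ^+ m.+1) - c 1| <= 6 * b * m.+1%:R.
  apply: (concentrated_inter_cubes Q f mQ mf q (l / 2) e h0 kappa0).
  - by rewrite /b; lra.
  - by rewrite -P2.
  - move=> v vI; apply: lt_le_trans (cP v vI) _.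
    by apply: lee_wpmul2r; rewrite ?lebesgue_outer_ge0 ?lee_fin.
have med v : 1 <= v <= 2 ^+ m.+1 -> exists2 r,
    maximal_median f t (inter_cube q (l / 2) e v) = r%:E & `|r - c v| <= b.
  move=> vI; have v0 : 0 < v by lra.
  apply: (maximal_median_concentrated _ _ _ _ _ _ _ _
    (lebesgue_outer_inter_cube _ _ _ _ _ v0) _ (cP v vI)) => //.
    by rewrite !mulr_gt0// exprn_gt0.
  by rewrite ts andbT; lra.
have [|r rE rc] := med (2 ^+ m.+1); first by rewrite le1 lexx.
have [|r' rE' rc'] := med 1; first by rewrite le1 lexx.
exists r, r'; rewrite P'1 P2; split=> //.
(* Since the dimension is at least 1, the two errors [b] between medians and constants are absorbed
   into a multiple of [m.+1]. *)
have n1 : beta <= beta * m.+1%:R by rewrite ler_peMr ?ler1n// ltW.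
rewrite (_ : 6 * b * m.+1%:R = 15 / 2 * (beta * m.+1%:R)) in c12; last by rewrite /b; field.
rewrite (_ : 10 * m.+1%:R * beta = 10 * (beta * m.+1%:R)); last by ring.
rewrite /b in rc rc'; move: c12 rc rc'; rewrite !ler_norml.
by move=> /andP[? ?] /andP[? ?] /andP[? ?]; apply/andP; split; lra.
Qed.

End median_child.

(** * Small medians along the grid force small values almost everywhere *)

Section stopping_time.
Context {R : realType} {m : nat}.
Implicit Types (P Q A N : set 'rV[R]_m.+1) (f : 'rV[R]_m.+1 -> R).
Local Notation mu := (@lebesgue_outer R m).

Lemma lebesgue_outer_lt_median P f (t M : R) : 0 <= t ->
  (M%:E < maximal_median f t P)%E ->
  (mu (P `&` [set y | (f y < M)%R]) <= t%:E * mu P)%E.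
Proof.
move=> t0 /ereal_sup_gt[_ [M' /= PM' <-]]; rewrite lte_fin => MM'.
apply: le_trans PM'; apply: le_lebesgue_outer => y [Py /= fy]; split=> //=.
exact: lt_trans fy MM'.
Qed.

(** A level above the supremum is not admissible, so the sublevel set exceeds the fraction [t] of
    [P]; its measurability in [Q] bounds the rest. *)
Lemma lebesgue_outer_ge_median P Q f (t M : R) :
  measurable (Q : set (lebesgue_rV R m)) ->
  measurable_fun (Q : set (lebesgue_rV R m)) (f : lebesgue_rV R m -> R) ->
  P `<=` Q -> (mu P < +oo)%E -> (maximal_median f t P < M%:E)%E ->
  (mu (P `&` [set y | (M <= f y)%R]) <= (1 - t)%:E * mu P)%E.
Proof.
move=> mQ mf PQ Poo medM.
have mS : measurable (Q `&` f @^-1` `]-oo, M[ : set (lebesgue_rV R m)).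
  by apply: mf => //; exact: measurable_itv.
have PE : mu P = (mu (P `&` [set y | (f y < M)%R]) + mu (P `&` [set y | (M <= f y)%R]))%E.
  rewrite (_ : _ `&` _ = P `&` (Q `&` f @^-1` `]-oo, M[)); last first.
    apply/seteqP; split=> y /=; rewrite in_itv /= => -[Py]; last by case.
    by split=> //; split=> //; exact: PQ.
  rewrite [X in (_ + mu X)%E](_ : _ = P `&` ~` (Q `&` f @^-1` `]-oo, M[)); last first.
    apply/seteqP; split=> y /=; rewrite in_itv /= => -[Py].
      by move=> My; split=> // -[_]; rewrite ltNge My.
    move=> nQf; split=> //; rewrite leNgt; apply/negP => fy; apply: nQf.
    by split=> //; exact: PQ.
  exact: (mS : mu.-caratheodory _).
have : (t%:E * mu P < mu (P `&` [set y | (f y < M)%R]))%E.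
  rewrite ltNge; apply/negP => PM; move: medM; rewrite ltNge => /negP; apply.
  by apply: ereal_sup_ubound; exists M.
have := lebesgue_outer_ge0 P; move: Poo PE.
case: (mu P) => [p| |]//= _.
case: (mu (P `&` _)) => [x| |]//; case: (mu (P `&` _)) => [y| |]//.
by rewrite -EFinD => -[->] _; rewrite -!EFinM lte_fin lee_fin; lra.
Qed.

Lemma measurable_null N : mu N = 0%E -> measurable (N : set (lebesgue_rV R m)).
Proof.
move=> N0; apply: le_caratheodory_measurable => X.
have XN0 : mu (X `&` N) = 0%E.
  by apply/eqP; rewrite eq_le lebesgue_outer_ge0 andbT -N0 le_lebesgue_outer.
by rewrite [Y in (Y + _)%E]XN0 add0e; exact: le_lebesgue_outer.
Qed.

Lemma lebesgue_outer_setU0 A N : mu A = 0%E -> mu N = 0%E -> mu (A `|` N) = 0%E.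
Proof.
move=> A0 N0; apply/eqP; rewrite eq_le lebesgue_outer_ge0 andbT.
by apply: le_trans (outer_measureU2 mu _ _) _;
  rewrite [X in (X + _)%E]A0 [X in (_ + X)%E]N0 adde0.
Qed.

Lemma lebesgue_outer_bigcup0 (F : nat -> set 'rV[R]_m.+1) :
  (forall k, mu (F k) = 0%E) -> mu (\bigcup_k F k) = 0%E.
Proof.
move=> F0; apply/eqP; rewrite eq_le lebesgue_outer_ge0 andbT.
apply: le_trans (outer_measure_sigma_subadditive mu _) _.
by rewrite eseries0// => k _ _; exact: F0.
Qed.

Variables (a : 'rV[R]_m.+1) (l : R) (f : 'rV[R]_m.+1 -> R) (t delta : R).
Hypotheses (l0 : 0 < l) (t0 : 0 < t) (t1 : t < 1).
Hypothesis mf : measurable_fun (cube a l : set (lebesgue_rV R m)) (f : lebesgue_rV R m -> R).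

(** In every grid cube around one of its points, the part with [f] above [delta] by a margin has
    density at most [1 - t], and the part below [- delta] by a margin at most [t]. Both bounds lie
    strictly between 0 and 1, so [dyadic_density] applies. *)
Lemma grid_median_null :
  mu [set x | [/\ half_open_cube a l x, delta < `|f x| &
    forall k, (`|maximal_median f t (grid_cube a l k x)| <= delta%:E)%E]] = 0%E.
Proof.
pose small x := forall k, (`|maximal_median f t (grid_cube a l k x)| <= delta%:E)%E.
(* Countably many positive margins, arbitrarily small, exhaust the strict inequality
   [delta < |f x|]. *)
have [u u0 gap] : exists2 u : nat -> R, forall n, 0 < u n &
    forall d, 0 < d -> exists n, u n < d.
  exists (fun n => n.+1%:R^-1) => [n|d d0]; first by rewrite invr_gt0.
  by have [n] := ltr_add_invr d0; rewrite add0r; exists n.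
pose A n := [set x | [/\ half_open_cube a l x, delta + u n <= f x & small x]].
pose A' n := [set x | [/\ half_open_cube a l x, f x < - delta - u n & small x]].
have finite N : N `<=` half_open_cube a l -> (mu N < +oo)%E.
  move=> NQ; apply: (@le_lt_trans _ _ (mu (cube a l))).
    apply: le_lebesgue_outer => x /NQ Qx i.
    by rewrite !mxE; have /andP[-> /ltW ->] := Qx i.
  by rewrite lebesgue_outer_cube// ltry.
have finite_cube k x : (mu (grid_cube a l k x) < +oo)%E.
  by rewrite lebesgue_outer_cube ?ltry// dyadic_side_gt0.
have A0 n : mu (A n) = 0%E.
  have t'I : 0 < 1 - t < 1 by rewrite subr_gt0 t1 /= ltrBlDr ltrDl.
  apply: (dyadic_density a l l0 _ _ t'I); first by apply: finite => x [].
  move=> k x [Qx _ /(_ k) med].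
  apply: (@le_trans _ _ (mu (grid_cube a l k x `&` [set y | delta + u n <= f y]))).
    by apply: le_lebesgue_outer => y [[_ fy _] xy].
  apply: (lebesgue_outer_ge_median _ (cube a l)) => //.
  - exact: measurable_box.
  - exact: grid_cube_sub_cube.
  - apply: (@le_lt_trans _ _ delta%:E); first by apply: le_trans med; exact: lee_abs.
    by rewrite lte_fin ltrDl.
have A'0 n : mu (A' n) = 0%E.
  have tI : 0 < t < 1 by apply/andP.
  apply: (dyadic_density a l l0 _ _ tI); first by apply: finite => x [].
  move=> k x [Qx _ /(_ k) med].
  apply: (@le_trans _ _ (mu (grid_cube a l k x `&` [set y | f y < - delta - u n]))).
    by apply: le_lebesgue_outer => y [[_ fy _] xy].
  apply: lebesgue_outer_lt_median; first exact: ltW.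
  have un := u0 n.
  move: med; case: (maximal_median _ _ _) => [r| |] //; rewrite lee_fin ler_norml lte_fin.
  by move=> /andP[? ?]; lra.
apply/eqP; rewrite eq_le outer_measure_ge0 andbT.
rewrite -(lebesgue_outer_setU0 _ _ (lebesgue_outer_bigcup0 _ A0)
  (lebesgue_outer_bigcup0 _ A'0)).
apply: le_lebesgue_outer => x [Qx fx sx].
move: fx; rewrite ltr_normr => /orP[] fx; [left | right].
  have [|n nP] := gap (f x - delta); first by rewrite subr_gt0.
  by exists n => //; split=> //; lra.
have [|n nP] := gap (- f x - delta); first by rewrite subr_gt0.
by exists n => //; split=> //; lra.
Qed.

End stopping_time.

(** * Selection of the stopping cubes *)

Theorem proposition4p1 (R : realType) (m : nat) (Q : set 'rV[R]_m.+1)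
  (s t delta beta : R) (f : 'rV[R]_m.+1 -> R) :
  is_cube Q ->
  0 < s <= 1 / 2 ->
  1 / 2 <= t <= 1 - s ->
  0 < delta -> 0 < beta ->
  measurable_fun (Q : set (lebesgue_rV R m)) (f : lebesgue_rV R m -> R) ->
  (`|maximal_median f t Q| <= delta%:E)%E ->
  let E := [set y | Q y /\ (beta%:E < local_sharp_maximal s Q f y)%E] in
  exists F : set (set 'rV[R]_m.+1),
    [/\ (forall P, F P -> dyadic_subcube Q P),
        nonoverlapping F,
        (forall P, F P -> ~ (P `<=` E)),
        (forall P, F P ->
          (delta%:E < `|maximal_median f t P|
             <= (delta + 10 * m.+1%:R * beta)%:E)%E) &
        {ae (@lebesgue_measure_rV R m), forall x,
          (Q `\` (E `|` \bigcup_(P in F) P)) x -> `|f x| <= delta}].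
Proof.
move=> [a [l [l0 ->]]] {Q} /andP[s0 s2] tI delta0 beta0 mf medQ E.
have /andP[t2 ts] := tI.
have mQ : measurable (cube a l : set (lebesgue_rV R m)) by exact: measurable_box.
(* If cubes were null, every real would be admissible in the median over [cube a l], which would
   then exceed [delta]. *)
have kappa0 : 0 < unit_cube_measure (R := R) (m := m).
  rewrite lt_neqAle unit_cube_measure_ge0 andbT; apply/negP => /eqP/esym k0.
  have Q0 : lebesgue_outer (cube a l) = 0%E by rewrite lebesgue_outer_cube// k0 mul0r.
  suff : ((delta + 1)%:E <= delta%:E)%E by rewrite lee_fin; lra.
  apply: le_trans medQ; apply: le_trans (lee_abs _).
  apply: ereal_sup_ubound; exists (delta + 1) => //=.
  apply: (@le_trans _ _ (lebesgue_outer (cube a l))).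
    by apply: le_lebesgue_outer => y [].
  by rewrite [X in (X <= _)%E]Q0 [X in (_ * X)%E]Q0 mule0.
pose D := grid_cube a l.
pose med k x := (`|maximal_median f t (D k x)|)%E.
pose stop k x := (delta%:E < med k x)%E /\ forall j, (j < k)%N -> (med j x <= delta%:E)%E.
have stop_inj k k' x : stop k x -> stop k' x -> k = k'.
  move=> [k1 k2] [k1' k2']; case: (ltngtP k k') => // [/k2'|/k2]; rewrite leNgt.
    by rewrite k1.
  by rewrite k1'.
(* The cell of generation [k] determines all earlier cubes, so stopping at [k] is a property of the
   cell. *)
have stop_index k x y : grid_index a l k y = grid_index a l k x -> stop k x -> stop k y.
  have DE j : (j <= k)%N -> grid_index a l k y = grid_index a l k x -> D j y = D j x.
    move=> jk yx; apply: grid_index_cube; exact: (grid_index_le a l l0 j k).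
  move=> yx [kx jx]; split; first by rewrite /med (DE k).
  by move=> j jk; rewrite /med (DE j (ltnW jk) yx); exact: jx.
exists [set P | exists x k, [/\ half_open_cube a l x, P = D k x, stop k x & ~ (P `<=` E)]].
split.
- by move=> P [x [k [Qx -> _ _]]]; exact: dyadic_subcube_grid.
- move=> P P' [x [k [Qx PE kx _]]] [x' [k' [Qx' P'E kx' _]]] PP'.
  (* A common interior point lies in both cells, hence inherits both stopping generations, which
     must agree. *)
  apply/seteqP; split=> // y [].
  rewrite PE P'E => /interior_grid_cube yx /interior_grid_cube yx'.
  have {}yx := yx l0; have {}yx' := yx' l0.
  have kk : k = k' by apply: (stop_inj k k' y); [exact: stop_index kx | exact: stop_index kx'].
  subst k'; apply: PP'; rewrite PE P'E; apply: grid_index_cube.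
  by rewrite -yx yx'.
- by move=> P [x [k []]].
- move=> P [x [[|k] [Qx PE [kx jx] nPE]]].
    (* Generation 0 is the initial cube, where the hypothesis forbids stopping; every stopping cube
       therefore has a parent in the grid. *)
    by move: kx; rewrite /med /D grid_cube0// ltNge medQ.
  rewrite PE; apply/andP; split=> //.
  have [y /not_implyP[Py nEy]] : exists y, ~ (P y -> E y) by apply/existsNP.
  have Qy : cube a l y by rewrite PE in Py; exact: grid_cube_sub_cube Py.
  have sharp : (local_sharp_maximal s (cube a l) f y <= beta%:E)%E.
    by rewrite leNgt; apply/negP => h; apply: nEy.
  rewrite PE in Py.
  have [r [r' [rE rE' rr]]] := maximal_median_child _ _ _ _ _ _ _ _ kappa0 mQ mf beta0 s2 tI
    (cube_child_grid a l l0 k x) (grid_cube_sub_cube a l l0 k x Qx) Py sharp.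
  have := jx k (ltnSn k); rewrite /med /D rE rE' /= !lee_fin => hr.
  rewrite (_ : r' = r + (r' - r)); last by ring.
  by apply: le_trans (ler_normD _ _) _; apply: lerD.
(* The exceptional set consists of the upper faces and of the points with large value but small
   medians at every generation. *)
- pose N := ((cube a l `\` half_open_box a (a + const_mx l)) `|`
    [set x | [/\ half_open_cube a l x, delta < `|f x| & forall k, (med k x <= delta%:E)%E]]).
  have N0 : lebesgue_outer N = 0%E.
    apply: lebesgue_outer_setU0; last by apply: grid_median_null => //; lra.
    apply/eqP; rewrite eq_le lebesgue_outer_ge0 andbT.
    rewrite -(lebesgue_outer_box_faces a (a + const_mx l)).
    by apply: le_lebesgue_outer; exact: boxD_half_open.
  exists N; split; [exact: measurable_null | exact: N0 |].
  move=> x /= /not_implyP[[Qx nEF] /negP].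
  rewrite -ltNge => fx.
  have [Qx'|nQx] := pselect (half_open_box a (a + const_mx l) x); last by left.
  have Hx : half_open_cube a l x by move=> i; have := Qx' i; rewrite !mxE.
  right; split=> // k0; rewrite leNgt; apply/negP => k0x.
  have ex : exists k, (delta%:E < med k x)%E by exists k0.
  case: (ex_minnP ex) => k kx mink; apply: (nEF); right.
  exists (D k x); last exact: grid_cube_refl.
  exists x, k; split=> //.
    by split=> // j jk; rewrite leNgt; apply/negP => /mink; rewrite leqNgt jk.
  (* A stopping cube contained in [E] is not selected, but then [x] itself belongs to [E]. *)
  move=> DE; apply: nEF; left; apply: DE; exact: grid_cube_refl.
Qed.
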